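(* Let $B \geq 2$ be an integer, let $w$ be a non-empty word over the alphabet $\{0,1,\ldots,B-1\}$, and let $N_{w,B}$, $v_B(w)$, $L(w)$ be as defined in the context. Let $d\ge 1$ and let $a_1,\ldots,a_d$ and $b_1,\ldots,b_d$ be nonnegative real numbers with $a_1+\cdots+a_d = b_1+\cdots+b_d$. Write, for $n \ge 1$, $$P(n) := \prod_{1 \leq i \leq d} \left(\frac{Bn+a_i}{Bn+b_i}\prod_{0 \leq k \leq B-1} \frac{B^2 n + B k + b_i}{B^2 n + B k + a_i}\right).$$ Then: (i) if $w = 0^j$ for some integer $j \geq 1$, $$\prod_{n \geq 1} P(n)^{N_{w,B}(n)} = \prod_{1 \leq i \leq d} \frac{\Gamma\!\left(1 + \frac{b_i}{B^{j+1}}\right)}{\Gamma\!\left(1+ \frac{a_i}{B^{j+1}}\right)};$$ (ii) if $w$ is not of the form $0^j$ for any $j \geq 1$, $$\prod_{n \geq 1} P(n)^{N_{w,B}(n)} = \prod_{1 \leq i \leq d} \frac{\Gamma\!\left(\frac{v_B(w)}{B^{L(w)}} + \frac{b_i}{B^{L(w)+1}}\right)}{\Gamma\!\left(\frac{v_B(w)}{B^{L(w)}} + \frac{a_i}{B^{L(w)+1}}\right)}.$$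
   Context: A word over $\{0,\ldots,B-1\}$ is a finite sequence of digits; $L(w)$ is its length and $0^j$ is the word of $j$ zeros. $v_B(w)$ is the integer whose base-$B$ expansion (possibly with leading zeros) is $w$. For an integer $n>0$: if $w$ begins with a nonzero digit or $w=0^j$ for some $j\ge1$, $N_{w,B}(n)$ is the number of (possibly overlapping) occurrences of $w$ as a block of consecutive digits in the base-$B$ expansion of $n$ (without leading zeros); if $w$ begins with $0$ but is not of the form $0^j$, $N_{w,B}(n)$ is the number of possibly overlapping occurrences of $w$ in the base-$B$ expansion of $n$ preceded by arbitrarily many zeros. Also $N_{w,B}(0)=0$. $\Gamma$ is Euler's Gamma function. *)

(* Defs.v *)
From mathcomp Require Import all_boot all_order all_algebra.
From mathcomp Require Import all_classical all_reals all_analysis.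

Set Implicit Arguments.
Unset Strict Implicit.
Unset Printing Implicit Defensive.

Import Order.TTheory GRing.Theory Num.Theory.
Import numFieldNormedType.Exports.

(* Words are sequences of natural numbers, most significant digit first. *)

Definition word_val (B : nat) (w : seq nat) : nat :=
  foldl (fun v c => v * B + c)%N 0%N w.

(* n > 0 has trunc_log B n + 1 digits in base B (for B >= 2). *)
Definition digits (B n : nat) : seq nat :=
  if n == 0%N then [::]
  else rev (mkseq (fun i => (n %/ B ^ i) %% B)%N (trunc_log B n).+1).

(* Possibly overlapping occurrences of a non-empty w as a block of s. *)
Definition occurrences (w s : seq nat) : nat :=
  count (fun i => prefix w (drop i s)) (iota 0 (size s)).

Definition zero_word (w : seq nat) : bool := w == nseq (size w) 0%N.

(* For w not a zero word, size w leading zeros stand for arbitrarily many of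
   them: see occurrences_pad. *)
Definition N_word (B : nat) (w : seq nat) (n : nat) : nat :=
  if n == 0%N then 0%N
  else if (head 0%N w != 0%N) || zero_word w then occurrences w (digits B n)
  else occurrences w (nseq (size w) 0%N ++ digits B n).

Lemma occurrences_pad (w s : seq nat) (m : nat) :
  ~~ zero_word w -> (size w <= m)%N ->
  occurrences w (nseq m 0%N ++ s) = occurrences w (nseq (size w) 0%N ++ s).
Proof.
move=> w_nz; elim: m => [|m IHm]; first by rewrite leqn0 => /eqP ->.
rewrite leq_eqVlt => /predU1P[-> //|]; rewrite ltnS => le_wm.
have no_prefix : prefix w (0%N :: nseq m 0%N ++ s) = false.
  apply/negbTE; apply: contra w_nz; rewrite prefixE -cat_cons => /eqP take_w.
  rewrite /zero_word -{1}take_w takel_cat; last by rewrite /= size_nseq leqW.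
  by rewrite -[_ :: _]/(nseq m.+1 _) take_nseq ?leqW.
rewrite -(IHm le_wm) /occurrences [nseq m.+1 _ ++ _]/=.
rewrite [size (_ :: _)]/= -add1n iotaD count_cat.
rewrite -[count _ (iota 0 1)]/(prefix w (0 :: nseq m 0 ++ s) + 0)%N no_prefix.
rewrite !add0n.
by rewrite -[1%N]addn0 iotaDl count_map; apply: eq_count => i.
Qed.

Local Open Scope classical_set_scope.
Local Open Scope ring_scope.

(* Euler's integral, meaningful for x > 0. *)
Definition Gamma (R : realType) (x : R) : R :=
  \int[@lebesgue_measure R]_(t in `]0, +oo[) (t `^ (x - 1) * expR (- t)).

Definition P_factor (R : realType) (B d : nat) (a b : 'I_d -> R) (n : nat) : R :=
  \prod_(i < d)
    ((B%:R * n%:R + a i) / (B%:R * n%:R + b i) *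
     \prod_(0 <= k < B)
       ((B%:R ^+ 2 * n%:R + B%:R * k%:R + b i) /
        (B%:R ^+ 2 * n%:R + B%:R * k%:R + a i))).

(* Main.v *)
(** Put g(n) = prod_i (B n + a_i) / (B n + b_i), so that
    P(n) = g(n) / prod_(k < B) g(B n + k).  Since N(n) - N(n / B) is 1 or 0
    according to whether w is a suffix of the expansion of n, i.e. whether
    n = v (mod B^L), the product of P(n)^N(n) over n <= M telescopes to the
    product of g over n < B (M + 1), n = v (mod B^L), divided by the product of
    g(n)^N(n) over M < n < B (M + 1).  As sum a_i = sum b_i, ln g(n) is O(1/n^2)
    while N(n) is O(log n), so the divisor tends to 1.  The rest is a quotient
    of Gamma functions because Gamma(n + y) is asymptotic to Gamma(n) n^y, which
    follows from Gamma(x + 1) = x Gamma(x) and, for s in [0, 1],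
    Gamma(x + s) <= x^s Gamma(x). *)
Require Import Defs.
From mathcomp Require Import all_boot all_order all_algebra.
From mathcomp Require Import all_classical all_reals all_analysis.
From mathcomp Require Import measurable_realfun zify ring lra.

Set Implicit Arguments.
Unset Strict Implicit.
Unset Printing Implicit Defensive.

Import Order.TTheory GRing.Theory Num.Theory.
Import numFieldNormedType.Exports.

(** * Counting occurrences *)

Lemma word_val_rcons B s c : word_val B (rcons s c) = (word_val B s * B + c)%N.
Proof. by rewrite /word_val -cats1 foldl_cat. Qed.

Lemma word_val_cat B s t :
  word_val B (s ++ t) = (word_val B s * B ^ size t + word_val B t)%N.
Proof.
elim/last_ind: t => [|t c IHt]; first by rewrite cats0 expn0 muln1 addn0.
by rewrite -rcons_cat !word_val_rcons IHt size_rcons expnS; lia.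
Qed.

Lemma word_val_nseq0 B n : word_val B (nseq n 0%N) = 0%N.
Proof. by elim: n => // n IHn; rewrite -addn1 nseqD cats1 word_val_rcons IHn. Qed.

Lemma ltn_word_val B s :
  all (fun c => c < B)%N s -> (word_val B s < B ^ size s)%N.
Proof.
elim/last_ind: s => // s c IHs; rewrite all_rcons => /andP[ltcB /IHs lts].
rewrite word_val_rcons size_rcons expnSr.
have : ((word_val B s).+1 * B <= B ^ size s * B)%N by rewrite leq_mul2r lts orbT.
lia.
Qed.

Lemma word_val_inj B s t : size s = size t ->
  all (fun c => c < B)%N s -> all (fun c => c < B)%N t ->
  word_val B s = word_val B t -> s = t.
Proof.
elim/last_ind: s t => [|s c IHs] t; first by case: t.
case/lastP: t => [|t e]; first by rewrite size_rcons.
rewrite !size_rcons !all_rcons !word_val_rcons => -[eqst].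
move=> /andP[ltcB ltsB] /andP[lteB lttB] eqv.
have B0 : (0 < B)%N by lia.
have := congr1 (divn ^~ B) eqv.
rewrite /= !divnMDl// !divn_small// !addn0 => eqv'.
by rewrite (IHs t) //; congr rcons; lia.
Qed.

Lemma digits0 B : digits B 0 = [::].
Proof. by []. Qed.

Lemma digits_rcons B n : (1 < B)%N -> (0 < n)%N ->
  digits B n = rcons (digits B (n %/ B)) (n %% B)%N.
Proof.
move=> B1 n0; have B0 : (0 < B)%N by lia.
rewrite /digits (gtn_eqF n0).
have [ltnB|leBn] := ltnP n B.
  have /eqP -> : trunc_log B n == 0%N by rewrite trunc_log_eq0; lia.
  by rewrite divn_small// /mkseq/= expn0 divn1.
have q0 : (0 < n %/ B)%N by rewrite divn_gt0.
have -> : trunc_log B n = (trunc_log B (n %/ B)).+1.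
  apply: trunc_log_eq => //; have /= /andP[] := trunc_log_bounds B1 q0.
  by rewrite leq_divRL// ltn_divLR// -!expnSr => -> ->.
rewrite gtn_eqF//.
have mkseqS (f : nat -> nat) m : mkseq f m.+1 = f 0%N :: mkseq (f \o succn) m.
  by rewrite /mkseq/= (iotaDl 1 0) -map_comp.
rewrite mkseqS rev_cons expn0 divn1; congr (rcons (rev _) _).
by apply: eq_mkseq => i /=; rewrite expnS divnMA.
Qed.

Lemma all_digits B n : (1 < B)%N -> all (fun c => c < B)%N (digits B n).
Proof.
move=> B1; elim/ltn_ind: n => n IHn; have [->//|n0] := posnP n.
by rewrite digits_rcons// all_rcons ltn_mod ltnW//= IHn// ltn_Pdiv.
Qed.

Lemma word_val_digits B n : (1 < B)%N -> word_val B (digits B n) = n.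
Proof.
move=> B1; elim/ltn_ind: n => n IHn; have [->//|n0] := posnP n.
by rewrite digits_rcons// word_val_rcons IHn ?ltn_Pdiv// -divn_eq.
Qed.

Lemma size_digits_le B n : (size (digits B n) <= (trunc_log B n).+1)%N.
Proof. by rewrite /digits; case: eqP => // _; rewrite size_rev size_mkseq. Qed.

Lemma occurrences_le w s : (occurrences w s <= size s)%N.
Proof. by rewrite (leq_trans (count_size _ _))// size_iota. Qed.

(** The two alternatives exclude each other by size, so the booleans add up as numbers, the form
    needed for the count in [occurrences_rcons]. *)
Lemma prefix_rconsE (T : eqType) (w t : seq T) c :
  prefix w (rcons t c) = (prefix w t + (w == rcons t c))%N :> nat.
Proof.
rewrite !prefixE -cats1 take_cat.
have [ltwt|letw] := ltnP (size w) (size t).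
  case: (w =P _) => [/(congr1 size)|_]; last by rewrite addn0.
  by rewrite size_cat/=; lia.
rewrite [take _ t]take_oversize//.
case: (t =P w) => [->|/eqP tw].
  rewrite subnn take0 cats0 eqxx; case: eqP => // /(congr1 size).
  by rewrite size_cat/=; lia.
rewrite add0n; have [ltw|] := ltnP (size t) (size w).
  by rewrite take_oversize 1?eq_sym//= subn_gt0.
move=> lewt; have -> : (size w - size t)%N = 0%N by apply/eqP.
rewrite take0 cats0 (negbTE tw); case: (w =P _) => // wE.
by move: lewt; rewrite wE size_cat addn1 ltnn.
Qed.

Lemma suffix_consE (T : eqType) (w t : seq T) x :
  suffix w (x :: t) = (suffix w t + (w == x :: t))%N :> nat.
Proof. by rewrite /suffix rev_cons prefix_rconsE -rev_cons (can_eq revK). Qed.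

(** [occurrences] unrolls at the head, while the new digit comes at the end. In the induction on
    [s], prefixes and suffixes of the longer word both split off the case where [w] is the whole
    word, and these two equal terms match. *)
Lemma occurrences_rcons w s c : w != [::] ->
  occurrences w (rcons s c) = (occurrences w s + suffix w (rcons s c))%N.
Proof.
have step y t : occurrences w (y :: t) = (prefix w (y :: t) + occurrences w t)%N.
  by rewrite /occurrences/= (iotaDl 1 0) count_map.
move=> w0; elim: s => [|x s IHs].
  rewrite [rcons _ _]/= step suffix_consE (prefix_rconsE w [::]).
  by rewrite prefixs0 suffixs0 (negbTE w0) addnC.
rewrite rcons_cons step IHs step (prefix_rconsE w (x :: s)) suffix_consE.
rewrite rcons_cons addnACA addnC.
move: (prefix _ _ : nat) (occurrences _ _) (suffix _ _ : nat) (w == _ : nat) => *; lia.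
Qed.

(** The last [size w] digits of [s] carry its value mod [B ^ size w], and words of equal length are
    determined by their values. *)
Lemma suffix_word_val B w s : all (fun c => c < B)%N w ->
  all (fun c => c < B)%N s -> (size w <= size s)%N ->
  suffix w s = (word_val B s == word_val B w %[mod B ^ size w]).
Proof.
move=> ltw lts les; rewrite suffixE -{3}(cat_take_drop (size s - size w) s).
have sd : size (drop (size s - size w) s) = size w by rewrite size_drop; lia.
have ltd : all (fun c => c < B)%N (drop (size s - size w) s).
  by move: lts; rewrite -{1}(cat_take_drop (size s - size w) s) all_cat => /andP[].
have := ltn_word_val ltd; rewrite sd => ltv.
rewrite word_val_cat sd modnMDl !modn_small ?ltn_word_val//.
apply/eqP/eqP => [-> //|]; exact: word_val_inj.
Qed.

(* The zero word gets B ^ size w, not 0: in all cases the n > 0 whose expansion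
   ends with w are then the residue B w + B ^ size w * m with m >= 0. *)
Definition residue B w :=
  if zero_word w then (B ^ size w)%N else word_val B w.

Lemma zero_wordP w : reflect (exists j, w = nseq j 0%N) (zero_word w).
Proof.
apply: (iffP eqP) => [->|[j ->]]; last by rewrite size_nseq.
by eexists.
Qed.

Lemma word_val_gt0 B w : (0 < B)%N -> ~~ zero_word w -> (0 < word_val B w)%N.
Proof.
move=> B0; elim/last_ind: w => // w c IHw nz; rewrite word_val_rcons.
have [c0|] := posnP c; last lia.
rewrite addn_gt0 muln_gt0 B0 andbT IHw//; apply: contra nz => /zero_wordP[j ->].
by apply/zero_wordP; exists j.+1; rewrite c0 -cats1 -addn1 nseqD.
Qed.

Lemma residue_bounds B w : (1 < B)%N -> all (fun c => c < B)%N w ->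
  (0 < residue B w <= B ^ size w)%N.
Proof.
move=> B1 ltw; rewrite /residue; case: ifPn => [_|nz].
  by rewrite leqnn expn_gt0 ltnW.
by rewrite word_val_gt0 ?(ltnW (ltn_word_val ltw)) ?(ltnW B1).
Qed.

Lemma leq_word_val B w : (0 < B)%N -> head 0%N w != 0%N ->
  (B ^ (size w).-1 <= word_val B w)%N.
Proof.
case: w => // c w B0 /= c0; rewrite -cat1s word_val_cat.
by rewrite /word_val/=; case: c c0 => // c _; rewrite mul0n add0n mulSn; lia.
Qed.

(** Appending the last digit of [n] to the expansion of [n %/ B] creates at most one occurrence, the
    one at the very end. *)
Lemma N_word_rec B w n : (1 < B)%N -> w != [::] -> all (fun c => c < B)%N w ->
  (0 < n)%N ->
  N_word B w n = (N_word B w (n %/ B) + (n == residue B w %[mod B ^ size w]))%N.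
Proof.
move=> B1 w0 ltw n0; rewrite /N_word (gtn_eqF n0).
have B0 := ltnW B1.
have resE : (n == residue B w %[mod B ^ size w]) =
            (n == word_val B w %[mod B ^ size w]).
  rewrite /residue; case: ifP => // /zero_wordP[j wj].
  by rewrite wj word_val_nseq0 size_nseq modnn mod0n.
rewrite resE; case: ifPn => [wh|].
  rewrite digits_rcons// occurrences_rcons//; congr addn.
    by case: eqP => // ->.
  rewrite -digits_rcons//.
  (* An expansion shorter than [w] does not end with [w], and the congruence must fail too: it would
     make [n] equal to [word_val B w], which is too large if [w] starts with a nonzero digit and is
     0 for a zero word. *)
  have [les|lts] := leqP (size w) (size (digits B n)).
    by rewrite (suffix_word_val ltw) ?all_digits// word_val_digits.
  rewrite (_ : suffix _ _ = false); last first.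
    by apply/negbTE/negP => /size_suffix/(leq_trans lts); rewrite ltnn.
  case: eqP => // nw.
  have ltn : (n < B ^ size (digits B n))%N.
    by rewrite -{1}(word_val_digits n B1) ltn_word_val ?all_digits.
  case/orP: wh => wh.
    have leB : (B ^ size (digits B n) <= B ^ (size w).-1)%N.
      by rewrite leq_pexp2l// -ltnS (ltn_predK lts).
    have := leq_trans ltn (leq_trans leB (leq_word_val B0 wh)).
    move: nw; rewrite !modn_small ?ltn_word_val//; first by move=> ->; rewrite ltnn.
    by rewrite (ltn_trans ltn)// ltn_exp2l.
  move: nw; case/zero_wordP: wh => j wj; rewrite wj word_val_nseq0 mod0n.
  rewrite modn_small -?wj; first by move=> nE; rewrite nE in n0.
  by rewrite (ltn_trans ltn)// ltn_exp2l.
rewrite negb_or => /andP[_ wnz].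
set p := nseq _ _.
have ap : all (fun c => c < B)%N p by rewrite all_nseq B0 orbT.
have vp s : word_val B (p ++ s) = word_val B s.
  by rewrite word_val_cat word_val_nseq0.
rewrite digits_rcons// -rcons_cat occurrences_rcons// rcons_cat -digits_rcons//.
congr addn.
  (* At [n %/ B = 0] the count is 0 by convention, but the padding remains: a block of zeros
     contains only zero words. *)
  case: eqP => // ->; rewrite digits0 cats0.
  apply/eqP; rewrite -leqn0 leqNgt -has_count; apply/hasPn => i _.
  apply: contra wnz => /prefixP[t].
  rewrite drop_nseq => E; apply/zero_wordP; exists (size w).
  apply/all_pred1P.
  have : all (pred1 0%N) (w ++ t) by rewrite -E all_nseq/= orbT.
  by rewrite all_cat => /andP[].
rewrite (suffix_word_val ltw) ?vp ?word_val_digits//.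
  by rewrite all_cat ap all_digits.
by rewrite size_cat size_nseq leq_addr.
Qed.

Lemma N_word_le B w n : (N_word B w n <= size w + (trunc_log B n).+1)%N.
Proof.
rewrite /N_word; case: eqP => // _; case: ifP => _.
  by rewrite (leq_trans (occurrences_le _ _))// (leq_trans (size_digits_le _ _))// leq_addl.
by rewrite (leq_trans (occurrences_le _ _))// size_cat size_nseq leq_add2l size_digits_le.
Qed.

Local Open Scope classical_set_scope.
Local Open Scope ring_scope.

(** * The Gamma function *)

(** The concave function [u ^ s] lies below its tangent at 1. With weights [s] and [1 - s], the
    terms in [ln u] of [h1] and [h2] cancel. *)
Lemma powR_tangent (R : realType) (u s : R) : 0 < u -> 0 <= s <= 1 ->
  u `^ s <= 1 - s + s * u.
Proof.
move=> u0 /andP[s0 s1]; rewrite /powR gt_eqF//.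
set l := ln u; set z := expR (s * l).
have z0 : 0 < z := expR_gt0 _.
have h1 : z * (1 + (1 - s) * l) <= u.
  have -> : u = z * expR ((1 - s) * l).
    by rewrite -expRD -mulrDl addrC subrK mul1r lnK.
  by rewrite ler_pM2l// expR_ge1Dx.
have h2 : z * (1 - s * l) <= 1.
  by rewrite -[leRHS](expRxMexpNx_1 (s * l)) ler_pM2l// expR_ge1Dx.
nra.
Qed.

(* From ln (t / (2 x)) <= t / (2 x) - 1. *)
Lemma powR_expRN_le (R : realType) (x t : R) : 0 < x -> 0 < t ->
  t `^ x * expR (- t) <= (2 * x) `^ x * expR (- (t / 2)).
Proof.
move=> x0 t0; have x20 : 0 < 2 * x by rewrite mulr_gt0.
rewrite /powR !gt_eqF// -!expRD ler_expR.
have : ln (1 + (t / (2 * x) - 1)) <= t / (2 * x) - 1.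
  by apply: le_ln1Dx; rewrite ltrBrDl subrr divr_gt0.
rewrite addrCA subrr addr0 ln_div ?posrE// lerBlDr => h.
have : x * ln t <= x * (t / (2 * x) - 1 + ln (2 * x)) by rewrite ler_pM2l.
have -> : x * (t / (2 * x) - 1 + ln (2 * x)) = t / 2 - x + x * ln (2 * x).
  by field; rewrite gt_eqF.
lra.
Qed.

Lemma powR_expRN_cvgy (R : realType) (x : R) : 0 < x ->
  t `^ x * expR (- t) @[t --> +oo%R] --> (0 : R).
Proof.
move=> x0.
have bound0 : (2 * x) `^ x * expR (- (t / 2)) @[t --> +oo%R] --> (0 : R).
  rewrite -[X in _ --> X](mulr0 ((2 * x) `^ x)).
  apply: cvgM; first exact: cvg_cst.
  apply: (@cvg_comp _ _ _ (fun t : R => t / 2) (fun t => expR (- t)) _ (pinfty_nbhs R)).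
    by apply: gt0_cvgMly => //; rewrite invr_gt0.
  exact: cvgr_expR.
apply: squeeze_cvgr (cvg_cst (0 : R)) bound0.
near=> t; rewrite mulr_ge0 ?powR_ge0 ?expR_ge0//=.
by apply: powR_expRN_le => //; near: t; exact: nbhs_pinfty_gt.
Unshelve. all: by end_near. Qed.

Section eGamma.
Variable R : realType.
Notation mu := (@lebesgue_measure R).

(** Extended-real Gamma, which allows monotone convergence and comparison of integrals before
    finiteness is known. *)
Definition eGamma (x : R) : \bar R :=
  (\int[mu]_(t in `]0%R, +oo[) (t `^ (x - 1) * expR (- t))%:E)%E.

(** Compact intervals exhausting the half-line; the shift by 2 makes the left endpoint strictly
    smaller than the right one. *)
Let trunc (n : nat) : set R := `[n.+2%:R^-1, n.+2%:R].

Let trunc_bigcup : \bigcup_n trunc n = [set` `]0%R, +oo[].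
Proof.
apply/seteqP; split => t /=.
  move=> [n _]; rewrite /trunc /= !in_itv/= andbT => /andP[+ _].
  by apply: lt_le_trans; rewrite invr_gt0.
rewrite in_itv/= andbT => t0.
have it0 : 0 < t^-1 by rewrite invr_gt0.
(* A bound on the sum [t + t^-1] controls both endpoints at once. *)
pose n := (Num.truncn (t + t^-1)).+1.
have tn : t + t^-1 < n.+2%:R.
  apply: (lt_trans (Num.Theory.truncnS_gt _)).
  by rewrite ltr_nat.
exists n => //; rewrite /trunc/= in_itv/=; apply/andP; split.
  by rewrite invf_ple ?posrE//; lra.
by lra.
Qed.

Lemma measurable_eGamma (x : R) (D : set R) : measurable D ->
  measurable_fun D (fun t : R => t `^ (x - 1) * expR (- t)).
Proof.
move=> mD; apply: measurable_funM.
  apply: measurable_funTS; exact: measurable_powR.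
by apply: measurableT_comp => //.
Qed.

Lemma eGamma_ge0 (x : R) : (0 <= eGamma x)%E.
Proof.
by apply: integral_ge0 => t _; rewrite lee_fin mulr_ge0 ?powR_ge0 ?expR_ge0.
Qed.

Lemma eGamma_trunc_cvg (x : R) :
  (\int[mu]_(t in trunc n) (t `^ (x - 1) * expR (- t))%:E)%E @[n --> \oo]
    --> eGamma x.
Proof.
rewrite /eGamma -trunc_bigcup; apply: ge0_nondecreasing_set_cvg_integral.
- move=> m n mn; rewrite subsetEset; apply: subset_itv; rewrite bnd_simp.
    by rewrite lef_pV2 ?posrE// ler_nat.
  by rewrite ler_nat.
- by move=> n; exact: measurable_itv.
- by move=> n; apply/measurable_EFinP; apply: measurable_eGamma; exact: measurable_itv.
- by move=> n t _; rewrite lee_fin mulr_ge0 ?powR_ge0 ?expR_ge0.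
Qed.

Lemma eGamma1 : eGamma 1 = 1%E.
Proof.
rewrite /eGamma; under eq_integral do rewrite subrr powRr0 mul1r.
rewrite integral_itv_obnd_cbnd; last first.
  apply/measurable_EFinP; exact: measurableT_comp.
have cN : continuous (fun t : R => expR (- t)).
  by move=> t; apply: continuous_comp; [exact: opp_continuous|exact: continuous_expR].
rewrite (@ge0_continuous_FTC2y _ _ (fun t => - expR (- t)) 0 0).
- by rewrite oppr0 expR0 EFinN oppeK add0e.
- by move=> t _; exact: expR_ge0.
- exact: continuous_subspaceT.
- by rewrite -oppr0; apply: cvgN; exact: cvgr_expR.
- by move=> t _; exact: ex_derive.
- by apply: cvg_at_right_filter; apply: cvgN; exact: cN.
- move=> t _; rewrite derive1E derive_val; lra.
Qed.

End eGamma.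

(** * Functional equation and growth bound for the Gamma integral *)

Section functional_equation.
Variable R : realType.
Notation mu := (@lebesgue_measure R).

(** Integration by parts with [t ^ x] and [- expR (- t)], away from 0 because [t ^ (x - 1)] may be
    singular there. *)
Lemma eGamma_trunc_parts (x p q : R) : 0 < x -> 0 < p < q ->
  (\int[mu]_(t in `[p, q]) (t `^ (x + 1 - 1) * expR (- t))%:E =
   (p `^ x * expR (- p) - q `^ x * expR (- q))%:E +
   x%:E * \int[mu]_(t in `[p, q]) (t `^ (x - 1) * expR (- t))%:E)%E.
Proof.
move=> x0 /andP[p0 pq].
have pos t : t \in `[p, q] -> 0 < t.
  by rewrite in_itv/= => /andP[+ _]; exact: lt_le_trans.
have pos' (t : R) : t \in `]p, q[ -> 0 < t.
  by rewrite in_itv/= => /andP[/(lt_trans p0)].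
have cN : continuous (fun t : R => expR (- t)).
  by move=> t; apply: continuous_comp; [exact: opp_continuous|exact: continuous_expR].
have cP (a t : R) : 0 < t -> {for t, continuous (fun t : R => t `^ a)}.
  move=> t0; apply/differentiable_continuous; rewrite -derivable1_diffP.
  by apply: ex_derive; exact: is_derive1_powR.
have dcP : derivable_oo_LRcontinuous (fun t : R => t `^ x) p q.
  split=> [t /pos' t0||].
  - by apply: ex_derive; exact: is_derive1_powR.
  - by apply: cvg_at_right_filter; exact: cP.
  - by apply: cvg_at_left_filter; apply: cP; exact: lt_trans pq.
have dcN : derivable_oo_LRcontinuous (fun t : R => - expR (- t)) p q.
  split=> [t _||].
  - exact: ex_derive.
  - by apply: cvg_at_right_filter; apply: cvgN; exact: cN.
  - by apply: cvg_at_left_filter; apply: cvgN; exact: cN.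
have dP : {in `]p, q[, (fun t : R => t `^ x)^`()%classic =1 (fun t => x * t `^ (x - 1))}.
  by move=> t /pos' t0; rewrite powR_derive1// in_itv/= t0.
have dN : {in `]p, q[, (fun t : R => - expR (- t))^`()%classic =1 (fun t => expR (- t))}.
  by move=> t _; rewrite derive1E derive_val; lra.
have cxP : {within `[p, q], continuous (fun t => x * t `^ (x - 1))}.
  apply/subspace_continuousP => t /= tpq; apply: cvg_within_filter.
  by apply: cvgM; [exact: cvg_cst|apply: cP; exact: pos].
have cN' : {within `[p, q], continuous (fun t : R => expR (- t))}.
  exact: continuous_subspaceT.
rewrite addrK (integration_by_parts pq cxP dcP dP cN' dcN dN).
have -> : (\int[mu]_(t in `[p, q]) (x * t `^ (x - 1) * - expR (- t))%:E =
   - (x%:E * \int[mu]_(t in `[p, q]) (t `^ (x - 1) * expR (- t))%:E))%E.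
  rewrite -ge0_integralZl_EFin//; last 3 first.
  - by move=> t _; rewrite lee_fin mulr_ge0 ?powR_ge0 ?expR_ge0.
  - by apply/measurable_EFinP; exact: measurable_eGamma.
  - exact: ltW.
  rewrite -integral_ge0N//; last first.
    by move=> t _; rewrite lee_fin !mulr_ge0 ?powR_ge0 ?expR_ge0// ltW.
  by apply: eq_integral => t _; rewrite -EFinM -EFinN mulrN mulrA.
rewrite oppeK; congr (_%:E + _)%E; lra.
Qed.

Lemma invr_natSS_cvg0 : (n.+2%:R^-1 : R) @[n --> \oo] --> (0 : R).
Proof.
have := @cvg_harmonic R; rewrite -(cvg_shiftS (@harmonic R)).
by [].
Qed.

Lemma natSS_cvgy : (n.+2%:R : R) @[n --> \oo] --> +oo%R.
Proof.
have -> : (fun n => n.+2%:R : R) = (fun n => (n + 2)%N%:R).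
  by apply/funext => n; rewrite addn2.
by rewrite (cvg_shiftn 2 (fun n => n%:R : R)); exact: cvgr_idn.
Qed.

(** Limit of [eGamma_trunc_parts], whose boundary terms vanish at 0 and at infinity. It is stated in
    the extended reals because [eGamma_fin] is deduced from it. *)
Lemma eGammaD1 (x : R) : 0 < x -> eGamma (x + 1) = (x%:E * eGamma x)%E.
Proof.
move=> x0.
have boundary0 : (n.+2%:R^-1 `^ x * expR (- n.+2%:R^-1) -
    n.+2%:R `^ x * expR (- n.+2%:R) : R) @[n --> \oo] --> (0 : R).
  rewrite -[X in _ --> X](subr0 0); apply: cvgB; last first.
    have /cvg_pinftyP := powR_expRN_cvgy x0.
    by move/(_ _ natSS_cvgy).
  rewrite -[X in _ --> X](mul0r (expR (- 0))); apply: cvgM.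
    have /cvg_at_rightP := powR_cvg0 x0.
    apply; split; last exact: invr_natSS_cvg0.
    by move=> n; rewrite invr_gt0.
  apply: (continuous_cvg _ (@continuous_expR R _)).
  by apply: cvgN; exact: invr_natSS_cvg0.
suff h : (\int[mu]_(t in `[(n.+2%:R^-1)%R, n.+2%:R%R])
    (t `^ (x + 1 - 1) * expR (- t))%:E)%E @[n --> \oo] --> (x%:E * eGamma x)%E.
  by apply: cvg_unique (@eGamma_trunc_cvg R (x + 1)) h.
rewrite -[(x%:E * eGamma x)%E]add0e.
have lt_invn (n : nat) : 0 < (n.+2%:R^-1 : R) < n.+2%:R.
  have n1 : (1 : R) < n.+2%:R by rewrite ltr1n.
  have n0 := lt_trans ltr01 n1.
  apply/andP; split; first by rewrite invr_gt0.
  by apply: (lt_trans _ n1); rewrite invf_lt1.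
under eq_cvg do rewrite (eGamma_trunc_parts x0 (lt_invn _)).
apply: cvgeD.
- by rewrite fin_num_adde_defr.
- by apply/fine_cvgP; split; [exact: nearW|exact: boundary0].
- apply: cvgeZl => //; exact: eGamma_trunc_cvg.
Qed.

(* Integrates weighted AM-GM, (t / x)^s <= 1 - s + s (t / x); the first moment is
   eGamma (x + 1) = x * eGamma x, so the two terms add up to eGamma x. *)
Lemma eGammaD_le (x s : R) : 0 < x -> 0 <= s <= 1 ->
  (eGamma (x + s) <= (x `^ s)%:E * eGamma x)%E.
Proof.
move=> x0 s01; have /andP[s0 s1] := s01.
have -> : ((x `^ s)%:E * eGamma x = ((1 - s) * x `^ s)%:E * eGamma x +
    (s / x * x `^ s)%:E * eGamma (x + 1))%E.
  rewrite eGammaD1// muleA -EFinM -ge0_muleDl ?lee_fin ?mulr_ge0 ?powR_ge0//.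
  - by rewrite -EFinD; congr (_%:E * _)%E; field; rewrite gt_eqF.
  - by rewrite subr_ge0.
  - by rewrite invr_ge0 ltW.
  - exact: ltW.
have mE (a : R) : measurable_fun ([set` `]0%R, +oo[] : set R)
    (EFin \o (fun t : R => t `^ (a - 1) * expR (- t))).
  by apply/measurable_EFinP; exact: measurable_eGamma.
have k0 a t : (0 <= (t `^ (a - 1) * expR (- t))%:E :> \bar R)%E.
  by rewrite lee_fin mulr_ge0 ?powR_ge0 ?expR_ge0.
have c1 : 0 <= (1 - s) * x `^ s by rewrite mulr_ge0 ?powR_ge0// subr_ge0.
have c2 : 0 <= s / x * x `^ s by rewrite !mulr_ge0 ?powR_ge0// invr_ge0 ltW.
rewrite /eGamma -!ge0_integralZl_EFin//; [|exact: (mE (x + 1))|exact: mE].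
rewrite -ge0_integralD//; last 4 first.
- by move=> t _; apply: mule_ge0; [rewrite lee_fin|exact: k0].
- by apply: measurable_funeM; exact: mE.
- by move=> t _; apply: mule_ge0; [rewrite lee_fin|exact: k0].
- by apply: measurable_funeM; exact: mE.
apply: ge0_le_integral => //.
- exact: mE.
- by apply: emeasurable_funD; apply: measurable_funeM; exact: mE.
move=> t; rewrite /= in_itv/= andbT => t0.
rewrite -!EFinM -EFinD lee_fin.
have -> : t `^ (x + s - 1) = t `^ (x - 1) * (x `^ s * (t / x) `^ s).
  rewrite -powRM; [|exact: ltW|by rewrite divr_ge0 ?ltW].
  rewrite [x * _]mulrC divfK ?gt_eqF// -powRD ?(gt_eqF t0) ?implybT//.
  by congr (_ `^ _); ring.
rewrite addrK -(mulr_powRB1 (ltW t0) x0).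
have h := powR_tangent (divr_gt0 t0 x0) s01.
have : t `^ (x - 1) * (x `^ s * (t / x) `^ s) * expR (- t) <=
    t `^ (x - 1) * (x `^ s * (1 - s + s * (t / x))) * expR (- t).
  by rewrite ler_wpM2r ?expR_ge0// ler_wpM2l ?powR_ge0// ler_wpM2l ?powR_ge0.
by move/le_trans; apply; rewrite le_eqVlt; apply/orP; left; apply/eqP; ring.
Qed.

End functional_equation.

Section Gamma.
Variable R : realType.
Implicit Types x y s : R.

(** Induction adapted to the functional equation: the interval ]0, 1] is the base case, and every
    positive real reaches it by subtracting 1 repeatedly. *)
Lemma pos_real_ind (P : R -> Prop) :
  (forall s, 0 < s <= 1 -> P s) -> (forall x, 0 < x -> P x -> P (x + 1)) ->
  forall x, 0 < x -> P x.
Proof.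
move=> P1 PS x x0.
have [n] : exists n : nat, x <= n.+1%:R.
  by exists (Num.truncn x); rewrite ltW// Num.Theory.truncnS_gt.
elim: n x x0 => [|n IHn] x x0 xn; first by apply: P1; rewrite x0.
have [x1|x1] := leP x 1; first by apply: P1; rewrite x0.
rewrite -(subrK 1 x); apply: PS; first by rewrite subr_gt0.
by apply: IHn; rewrite ?subr_gt0// lerBlDr natr1.
Qed.

(* On ]0, 1], s * eGamma s = eGamma (1 + s) <= eGamma 1. *)
Lemma eGamma_fin x : 0 < x -> eGamma x \is a fin_num.
Proof.
move: x; apply: pos_real_ind => [s /andP[s0 s1]|x x0].
  have := @eGammaD_le R 1 s ltr01; rewrite ltW// s1 => /(_ isT).
  rewrite eGamma1 addrC eGammaD1// mule1 powR1.
  rewrite ge0_fin_numE ?eGamma_ge0//.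
  case: (eGamma s) (eGamma_ge0 s) => //= [r _ _|_]; first by rewrite ltry.
  by rewrite gt0_muley.
by move=> fx; rewrite eGammaD1// fin_numM.
Qed.

Lemma EFin_Gamma x : 0 < x -> (Gamma x)%:E = eGamma x.
Proof. by move=> x0; rewrite /Gamma /Rintegral fineK// eGamma_fin. Qed.

Lemma Gamma1 : Gamma (1 : R) = 1.
Proof. by apply: EFin_inj; rewrite EFin_Gamma// eGamma1. Qed.

Lemma GammaD1 x : 0 < x -> Gamma (x + 1) = x * Gamma x.
Proof.
by move=> x0; apply: EFin_inj; rewrite EFinM !EFin_Gamma ?addr_gt0// eGammaD1.
Qed.

Lemma GammaD_le x s : 0 < x -> 0 <= s <= 1 -> Gamma (x + s) <= x `^ s * Gamma x.
Proof.
move=> x0 s01; rewrite -lee_fin EFinM !EFin_Gamma ?eGammaD_le//.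
by case/andP: s01 => s0 _; rewrite ltr_pwDl.
Qed.

(** On ]0, 1], [GammaD_le] with exponent [1 - s] gives [1 = Gamma 1 <= s ^ (1 - s) * Gamma s]; the
    functional equation does the rest. *)
Lemma Gamma_gt0 x : 0 < x -> 0 < Gamma x.
Proof.
move: x; apply: pos_real_ind => [s /andP[s0 s1]|x x0 G0]; last first.
  by rewrite GammaD1// mulr_gt0.
have := @GammaD_le s (1 - s) s0; rewrite [s + _]addrC subrK Gamma1.
rewrite subr_ge0 s1 gerBl ltW// => /(_ isT) h.
by have := lt_le_trans ltr01 h; rewrite pmulr_rgt0// powR_gt0.
Qed.

End Gamma.

(** * Infinite products of rational factors as Gamma quotients *)

Lemma cvg_prod_ord (R : realType) d (f : 'I_d -> nat -> R) (l : 'I_d -> R) :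
  (forall i, f i n @[n --> \oo] --> l i) ->
  \prod_(i < d) f i n @[n --> \oo] --> \prod_(i < d) l i.
Proof.
by move=> fl; apply: cvg_big => // -[u v]; exact: mul_continuous.
Qed.

(* Bohr-Mollerup: G is Gamma up to a constant factor, which cancels below.  An
   abstract G also prevents conversion tests from unfolding the integral. *)
Section log_convex.
Context (R : realType) (G : R -> R).
Implicit Types x y s : R.
Hypothesis G_gt0 : forall x, 0 < x -> 0 < G x.
Hypothesis GD1 : forall x, 0 < x -> G (x + 1) = x * G x.
Hypothesis GD_le : forall x s, 0 < x -> 0 <= s <= 1 -> G (x + s) <= x `^ s * G x.

(** For [y] in ]0, 1] the quotient is squeezed between [(1 + y / n.+1)^-1] and 1; passing from [y]
    to [y + 1] multiplies it by [1 + y / n.+1]. *)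
Lemma log_convex_asymptotic y : 0 < y ->
  G (n.+1%:R + y) / (G n.+1%:R * n.+1%:R `^ y) @[n --> \oo] --> (1 : R).
Proof.
have addn_cvg (z : R) : 1 + z / n.+1%:R @[n --> \oo] --> (1 : R).
  rewrite -[X in _ --> X]addr0; apply: cvgD; first exact: cvg_cst.
  rewrite -[X in _ --> X](mulr0 z); apply: cvgM; first exact: cvg_cst.
  exact: cvg_harmonic.
move: y; apply: pos_real_ind => [s /andP[s0 s1]|y y0 IHy].
  (* The lower bound is GD_le at n + s with exponent 1 - s. *)
  have lower : (1 + s / n.+1%:R)^-1 @[n --> \oo] --> (1 : R).
    by rewrite -[X in _ --> X]invr1; apply: cvgV; [exact: oner_neq0|exact: addn_cvg].
  apply: squeeze_cvgr lower (cvg_cst (1 : R)).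
  apply: nearW => n; set M : R := n.+1%:R.
  have M0 : 0 < M by rewrite ltr0n.
  have Ms0 : 0 < M + s by rewrite addr_gt0.
  have GM0 := G_gt0 M0; have GMs0 := G_gt0 Ms0.
  have D0 : 0 < G M * M `^ s by rewrite mulr_gt0 ?powR_gt0.
  apply/andP; split; last first.
    by rewrite ler_pdivrMr// mul1r mulrC GD_le// s1 ltW.
  rewrite ler_pdivlMr// ler_pdivrMl; last by rewrite addr_gt0// divr_gt0.
  have h := @GD_le (M + s) (1 - s) Ms0.
  rewrite subr_ge0 s1 gerBl (ltW s0) in h; move/(_ isT) : h.
  have -> : M + s + (1 - s) = M + 1 by ring.
  rewrite GD1// => h.
  (* Weakening [M ^ s] to [(M + s) ^ s] lets the exponents [1 - s] and [s] add up to 1. *)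
  have hs : M `^ s <= (M + s) `^ s.
    by apply: ge0_ler_powR; rewrite ?nnegrE ?lerDl// ltW.
  have : M * G M * M `^ s <= (M + s) * G (M + s).
    have eMs : (M + s) `^ (1 - s) * (M + s) `^ s = M + s.
      by rewrite -powRD ?(gt_eqF Ms0) ?implybT// subrK powRr1// ltW.
    rewrite -[X in X * G (M + s)]eMs [leRHS]mulrAC ler_pM ?powR_ge0//.
    by rewrite mulr_ge0// ltW.
  rewrite -mulrA -ler_pdivlMl// => /le_trans; apply.
  rewrite le_eqVlt; apply/orP; left; apply/eqP; field.
  by rewrite gt_eqF.
rewrite -[X in _ --> X]mulr1; under eq_cvg => n.
  have M0 : 0 < n.+1%:R :> R by rewrite ltr0n.
  have -> : G (n.+1%:R + (y + 1)) / (G n.+1%:R * n.+1%:R `^ (y + 1)) =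
     G (n.+1%:R + y) / (G n.+1%:R * n.+1%:R `^ y) * (1 + y / n.+1%:R).
    rewrite addrA GD1 ?addr_gt0// powRD ?(gt_eqF M0) ?implybT// powRr1 ?ltW//.
    by field; rewrite !gt_eqF// ?powR_gt0// G_gt0.
  over.
by apply: cvgM; [exact: IHy|exact: addn_cvg].
Qed.

Lemma prod_addn_quotient y n : 0 < y ->
  \prod_(m < n) (m%:R + y) = G (n%:R + y) / G y.
Proof.
move=> y0; elim: n => [|n IHn].
  by rewrite big_ord0 add0r divff// gt_eqF// G_gt0.
rewrite big_ord_recr/= IHn -natr1 addrAC GD1 ?ltr_wpDl//.
by rewrite mulrAC [X in X / _]mulrC.
Qed.

(** By [prod_addn_quotient] the partial product is a product of quotients of [G], whose growth is
    known from [log_convex_asymptotic]. *)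
Lemma prod_ratio_cvg d (a b : 'I_d -> R) x : 0 < x ->
  (forall i, 0 <= a i) -> (forall i, 0 <= b i) ->
  \sum_(i < d) a i = \sum_(i < d) b i ->
  \prod_(m < n) \prod_(i < d) ((m%:R + (x + a i)) / (m%:R + (x + b i)))
     @[n --> \oo] --> \prod_(i < d) (G (x + b i) / G (x + a i)).
Proof.
move=> x0 a0 b0 ab; rewrite -cvg_shiftS/=.
have xa i : 0 < x + a i by rewrite ltr_pwDl.
have xb i : 0 < x + b i by rewrite ltr_pwDl.
pose r y n : R := G (n.+1%:R + y) / (G n.+1%:R * n.+1%:R `^ y).
have -> : (fun n => \prod_(m < n.+1) \prod_(i < d)
      ((m%:R + (x + a i)) / (m%:R + (x + b i)))) =
   (fun n => \prod_(i < d) (G (x + b i) / G (x + a i) *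
                           (r (x + a i) n / r (x + b i) n))).
  apply/funext => n; rewrite exchange_big/=.
  have M0 : 0 < n.+1%:R :> R by rewrite ltr0n.
  (* The asymptotics leave a power with exponent [a i - b i] for each [i]; the exponents sum to 0,
     so the product of these powers is 1. *)
  rewrite [LHS](_ : _ = \prod_(i < d) (G (x + b i) / G (x + a i) *
      (r (x + a i) n / r (x + b i) n)) * \prod_(i < d) n.+1%:R `^ (a i - b i)).
    have -> : \prod_(i < d) n.+1%:R `^ (a i - b i) =
        n.+1%:R `^ (\sum_(i < d) (a i - b i)) :> R.
      apply/esym; apply: big_morph.
        by move=> u v; rewrite powRD// (gt_eqF M0) implybT.
      by rewrite powRr0.
    by rewrite sumrB ab subrr powRr0 mulr1.
  rewrite -big_split/=; apply: eq_bigr => i _.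
  rewrite prodf_div !prod_addn_quotient// /r powRB ?(gt_eqF M0) ?implybT//.
  rewrite !(powRD (x := n.+1%:R)) ?(gt_eqF M0) ?implybT//.
  field.
  by rewrite !gt_eqF ?powR_gt0 ?G_gt0 ?(addr_gt0 M0).
apply: cvg_prod_ord => i.
rewrite -[X in _ --> X]mulr1; apply: cvgM; first exact: cvg_cst.
rewrite -[X in _ --> X]divr1; apply: cvgM; first exact: log_convex_asymptotic.
by apply: cvgV; [exact: oner_neq0|exact: log_convex_asymptotic].
Qed.

End log_convex.

(** * Telescoping the product *)

Lemma prod_ord_mul (R : comPzRingType) (h : nat -> R) B M :
  \prod_(n < B * M) h n = \prod_(m < M) \prod_(k < B) h (B * m + k)%N.
Proof.
elim: M => [|M IHM]; first by rewrite muln0 !big_ord0.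
rewrite big_ord_recr/= -IHM mulnSr.
by rewrite big_split_ord.
Qed.

(** The product of [g n ^ N n] over [n < B * M.+1] is computed twice: by cutting at [M.+1], and by
    splitting [N n] into [N (n %/ B) + e n]. *)
Lemma prod_block_expN (R : fieldType) (g : nat -> R) (N e : nat -> nat) B M :
  (0 < B)%N -> (forall n, (0 < n)%N -> g n != 0) -> N 0%N = 0%N ->
  (forall n, N n = N (n %/ B) + e n)%N ->
  \prod_(1 <= n < M.+1) (g n * \prod_(0 <= k < B) (g (B * n + k)%N)^-1) ^+ N n =
  (\prod_(n < B * M.+1) g n ^+ e n) / (\prod_(M.+1 <= n < B * M.+1) g n ^+ N n).
Proof.
move=> B0 g0 N0 Ne.
(* [g 0] may vanish, but it occurs with exponent [N 0 = 0]. *)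
have F0 n : g n ^+ N n != 0.
  by have [->|n0] := posnP n; rewrite ?N0 ?expr0 ?oner_neq0// expf_neq0// g0.
have F0' n k : (k < B)%N -> g (B * n + k)%N ^+ N n != 0.
  move=> kB; have [->|n0] := posnP n; rewrite ?N0 ?expr0 ?oner_neq0//.
  by rewrite expf_neq0// g0// addn_gt0 muln_gt0 B0 n0.
set T := \prod_(M.+1 <= n < _) _.
have T0 : T != 0 by rewrite prodf_seq_neq0; apply/allP => n _; apply/implyP.
have HT : \prod_(n < M.+1) g n ^+ N n * T = \prod_(n < B * M.+1) g n ^+ N n.
  rewrite -(big_mkord xpredT (fun n => g n ^+ N n)).
  rewrite -(big_mkord xpredT (fun n => g n ^+ N n)).
  by rewrite -big_cat_nat//= leq_pmull.
(* The quotient [n %/ B] is constant on blocks of [B] consecutive integers, which yields the inner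
   products over [k]. *)
have HE : \prod_(n < B * M.+1) g n ^+ N n =
    (\prod_(n < M.+1) \prod_(k < B) g (B * n + k)%N ^+ N n) *
    \prod_(n < B * M.+1) g n ^+ e n.
  rewrite (eq_bigr (fun n : 'I__ => g n ^+ N (n %/ B)%N * g n ^+ e n)); last first.
    by move=> n _; rewrite -exprD -Ne.
  rewrite big_split/= (prod_ord_mul (fun n => g n ^+ N (n %/ B)%N)); congr (_ * _).
  apply: eq_bigr => m _; apply: eq_bigr => k _.
  by rewrite mulnC divnMDl// divn_small// addn0.
set D := \prod_(n < M.+1) \prod_(k < B) g (B * n + k)%N ^+ N n in HE.
have D0 : D != 0.
  by apply/prodf_neq0 => m _; apply/prodf_neq0 => k _; rewrite F0'.
have -> : \prod_(1 <= n < M.+1) (g n * \prod_(0 <= k < B) (g (B * n + k)%N)^-1) ^+ N n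
   = (\prod_(n < M.+1) g n ^+ N n) / D.
  rewrite -prodf_div -(big_mkord xpredT (fun n => g n ^+ N n /
     \prod_(k < B) g (B * n + k)%N ^+ N n)).
  rewrite [RHS]big_nat_recl// N0 expr0 [X in 1 / X]big1 ?divr1 ?mul1r; last first.
    by move=> k _; rewrite expr0.
  rewrite big_add1/=; apply: eq_bigr => n _.
  rewrite exprMn big_mkord -prodrXl; congr (_ * _).
  by rewrite -prodfV; apply: eq_bigr => k _; rewrite exprVn.
apply/eqP; rewrite eqr_div// HT HE; apply/eqP; ring.
Qed.

(** As [0 < v <= Q], [v] is the least positive element of its class, and the upper index is the
    number of elements below [X], namely [(X - v) / Q] rounded up. *)
Lemma prod_residue (R : comPzRingType) (g : nat -> R) Q v X :
  (0 < v <= Q)%N ->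
  \prod_(n < X) g n ^+ ((0 < n)%N && (n == v %[mod Q])) =
  \prod_(m < (X + Q.-1 - v) %/ Q) g (v + Q * m)%N.
Proof.
move=> /andP[v0 vQ]; have Q0 : (0 < Q)%N by exact: leq_trans vQ.
elim: X => [|X IHX]; first by rewrite big_ord0 divn_small ?big_ord0//; lia.
rewrite big_ord_recr/= IHX.
have [X0|X0] := posnP X.
  by subst X; rewrite expr0 mulr1 !divn_small//; lia.
have [Xv|vX] := ltnP X v.
  rewrite !divn_small; [|lia..].
  rewrite !big_ord0 mul1r; case: eqP => // e.
  have : (X = v)%N.
    move: e; have [->|vQ'] := eqVneq v Q.
      by rewrite modnn modn_small; lia.
    by rewrite !modn_small//; lia.
  lia.
(* The count passes from [q] to [q + 1] if [r = 0], and stays at [q + 1] otherwise. *)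
have [q [r [rQ XE]]] : exists q r, (r < Q)%N /\ X = (v + (q * Q + r))%N.
  exists ((X - v) %/ Q)%N, ((X - v) %% Q)%N; rewrite ltn_mod Q0 -divn_eq; lia.
have -> : (X == v %[mod Q]) = (r == 0%N).
  rewrite XE -[X in _ == X %[mod _]]addn0 eqn_modDl modnMDl mod0n.
  by rewrite modn_small.
have [r0|r0] := posnP r.
  have -> : (X + Q.-1 - v)%N = (q * Q + Q.-1)%N by lia.
  have -> : (X.+1 + Q.-1 - v)%N = (q.+1 * Q + 0)%N by lia.
  rewrite !divnMDl// div0n addn0 divn_small ?addn0; last lia.
  by rewrite big_ord_recr/= expr1 XE r0 addn0 mulnC.
have -> : (X + Q.-1 - v)%N = (q.+1 * Q + r.-1)%N by lia.
have -> : (X.+1 + Q.-1 - v)%N = (q.+1 * Q + r)%N by lia.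
rewrite !divnMDl// !divn_small ?addn0; [|lia..].
by rewrite expr0 mulr1.
Qed.

(** * Convergence of the tail product to 1 *)

Section tail.
Variable R : realType.

(** The lower bound is the upper one applied to [(1 + x)^-1 = 1 - x / (1 + x)], together with
    [x / (1 + x) >= x - x ^ 2]. *)
Lemma ln1D_bounds (x : R) : 0 <= x -> x - x ^+ 2 <= ln (1 + x) <= x.
Proof.
move=> x0; have x1 : 0 < 1 + x by rewrite ltr_wpDr.
rewrite le_ln1Dx ?andbT; last by rewrite (lt_le_trans _ x0)// oppr_lt0.
have : ln (1 + - (x / (1 + x))) <= - (x / (1 + x)).
  by apply: le_ln1Dx; rewrite ltrN2 ltr_pdivrMr//; lra.
have -> : 1 + - (x / (1 + x)) = (1 + x)^-1 by field; rewrite gt_eqF.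
rewrite lnV ?posrE// lerN2; apply: le_trans.
rewrite ler_pdivlMr//; nra.
Qed.

Lemma ln_prod d (f : 'I_d -> R) : (forall i, 0 < f i) ->
  ln (\prod_(i < d) f i) = \sum_(i < d) ln (f i).
Proof.
move=> f0; suff [] : 0 < \prod_(i < d) f i /\
    ln (\prod_(i < d) f i) = \sum_(i < d) ln (f i) by [].
elim/big_rec2 : _ => [|i x y _ [y0 yE]]; first by rewrite ln1.
by rewrite mulr_gt0// lnM ?posrE// yE.
Qed.

(** The first-order terms [(a i - b i) / t] sum to 0 and can be subtracted; [ln1D_bounds] controls
    what remains. *)
Lemma ln_ratio_le d (a b : 'I_d -> R) : (forall i, 0 <= a i) -> (forall i, 0 <= b i) ->
  \sum_(i < d) a i = \sum_(i < d) b i ->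
  forall t, 0 < t ->
  `|ln (\prod_(i < d) ((t + a i) / (t + b i)))| <=
    (\sum_(i < d) (a i ^+ 2 + b i ^+ 2)) / t ^+ 2.
Proof.
move=> a0 b0 ab t t0.
have ta i : 0 < t + a i by rewrite ltr_wpDr.
have tb i : 0 < t + b i by rewrite ltr_wpDr.
have lnE (c : R) : 0 <= c -> ln (t + c) = ln t + ln (1 + c / t).
  move=> c0; rewrite -lnM ?posrE//; last by rewrite ltr_wpDr// divr_ge0// ltW.
  by congr ln; field; rewrite gt_eqF.
rewrite ln_prod; last by move=> i; rewrite divr_gt0.
have -> : \sum_(i < d) ln ((t + a i) / (t + b i)) =
   \sum_(i < d) (ln ((t + a i) / (t + b i)) - (a i - b i) / t).
  by rewrite sumrB -mulr_suml sumrB ab subrr mul0r subr0.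
rewrite mulr_suml; apply: (le_trans (ler_norm_sum _ _ _)); apply: ler_sum => i _.
rewrite ln_div ?posrE// !lnE//.
have a1 : 0 <= a i / t by rewrite divr_ge0// ltW.
have b1 : 0 <= b i / t by rewrite divr_ge0// ltW.
have /andP[] := ln1D_bounds a1; have /andP[] := ln1D_bounds b1.
rewrite !mulrDl mulNr -!exprVn -!exprMn ler_norml.
by move=> *; apply/andP; split; lra.
Qed.

(** A crude square-root bound on the logarithm, enough for [log m / m] to tend to 0. *)
Lemma trunc_log_sqr B m : (1 < B)%N -> (0 < m)%N -> (trunc_log B m ^ 2 <= 2 * m)%N.
Proof.
move=> B1 m0; have sqr_exp2 t : (t ^ 2 <= 2 * 2 ^ t)%N.
  elim: t => // t IHt; rewrite (expnS 2 t).
  by move: IHt (ltn_expl t (isT : 1 < 2)%N); rewrite -!mulnn; lia.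
apply: (leq_trans (sqr_exp2 _)); rewrite leq_mul2l/=.
by apply: leq_trans (trunc_logP B1 m0); case: trunc_log => // t; rewrite leq_exp2r.
Qed.

Lemma trunc_log_div_cvg0 B : (1 < B)%N ->
  (trunc_log B n.+1)%:R / n.+1%:R @[n --> \oo] --> (0 : R).
Proof.
move=> B1.
have s0 : 2 * Num.sqrt (n.+1%:R^-1) @[n --> \oo] --> (0 : R).
  rewrite -[X in _ --> X](mulr0 2); apply: cvgM; first exact: cvg_cst.
  rewrite -[X in _ --> X](@sqrtr0 R).
  by apply: continuous_cvg; [exact: sqrt_continuous|exact: cvg_harmonic].
apply: squeeze_cvgr (cvg_cst (0 : R)) s0; apply: nearW => n.
rewrite divr_ge0//=; set m : R := n.+1%:R; have m0 : 0 < m by rewrite ltr0n.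
rewrite -(@ler_pXn2r _ 2)// ?nnegrE ?divr_ge0 ?mulr_ge0 ?sqrtr_ge0//.
rewrite !exprMn sqr_sqrtr; last by rewrite invr_ge0 ltW.
have h : (trunc_log B n.+1)%:R ^+ 2 <= 2 * m.
  by rewrite -natrX -natrM ler_nat trunc_log_sqr.
rewrite exprVn ler_pdivrMr ?exprn_gt0//.
have -> : 2 ^+ 2 * m^-1 * m ^+ 2 = 4 * m by field; rewrite gt_eqF.
lra.
Qed.

(** The logarithm has at most [B * M.+1] terms, each at most [c + trunc_log B M.+1 + 1] times
    [C / M.+1 ^ 2], so it is O(log M / M). *)
Lemma prod_tail_cvg1 (g : nat -> R) (N : nat -> nat) (B c : nat) (C : R) :
  (1 < B)%N -> 0 <= C -> (forall n, (0 < n)%N -> 0 < g n) ->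
  (forall n, (0 < n)%N -> `|ln (g n)| <= C / n%:R ^+ 2) ->
  (forall n, N n <= c + trunc_log B n)%N ->
  \prod_(M.+1 <= n < B * M.+1) g n ^+ N n @[M --> \oo] --> (1 : R).
Proof.
move=> B1 C0 g0 gC Nc.
pose S M := \sum_(M.+1 <= n < B * M.+1) (N n)%:R * ln (g n).
have -> : (fun M => \prod_(M.+1 <= n < B * M.+1) g n ^+ N n) = expR \o S.
  apply/funext => M; rewrite /S /= big_nat [in RHS]big_nat expR_sum.
  apply: eq_bigr => n /andP[Mn _].
  have n0 : (0 < n)%N by exact: leq_ltn_trans Mn.
  by rewrite expRM_natl lnK// posrE g0.
rewrite -(@expR0 R); apply: continuous_cvg; first exact: continuous_expR.
have bound M : `|S M| <= B%:R * C * ((c + 1)%:R / M.+1%:R +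
    (trunc_log B M.+1)%:R / M.+1%:R).
  set m : R := M.+1%:R; have m0 : 0 < m by rewrite ltr0n.
  have -> : B%:R * C * ((c + 1)%:R / m + (trunc_log B M.+1)%:R / m) =
    (B * M.+1)%:R * ((c + (trunc_log B M.+1).+1)%:R * (C / m ^+ 2)).
    rewrite natrM -addn1 addnA addnAC !natrD; field; rewrite gt_eqF//.
  rewrite /S big_nat; apply: (le_trans (ler_norm_sum _ _ _)).
  apply: (@le_trans _ _ (\sum_(M.+1 <= n < B * M.+1 | (M.+1 <= n < B * M.+1)%N)
     ((c + (trunc_log B M.+1).+1)%:R * (C / m ^+ 2)))).
    apply: ler_sum => n /andP[Mn nB]; have n0 : (0 < n)%N by exact: leq_ltn_trans Mn.
    rewrite normrM normr_nat ler_pM//.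
      rewrite ler_nat (leq_trans (Nc n))// leq_add2l.
      rewrite -trunc_logMp//; exact/leq_trunc_log/ltnW.
    apply: (le_trans (gC _ n0)); rewrite ler_wpM2l// lef_pV2 ?posrE ?exprn_gt0 ?ltr0n//.
    by rewrite lerXn2r ?nnegrE// ler_nat.
  rewrite -big_nat big_const_nat iter_addr_0 -[leLHS]mulr_natl ler_wpM2r ?ler_nat ?leq_subr//.
  by rewrite mulr_ge0// divr_ge0// exprn_ge0// ltW.
apply: norm_cvg0.
have lim0 : B%:R * C * ((c + 1)%:R / M.+1%:R + (trunc_log B M.+1)%:R / M.+1%:R)
    @[M --> \oo] --> (0 : R).
  rewrite -[X in _ --> X](mulr0 (B%:R * C)); apply: cvgM; first exact: cvg_cst.
  rewrite -[X in _ --> X]addr0; apply: cvgD; last exact: trunc_log_div_cvg0.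
  rewrite -[X in _ --> X](mulr0 (c + 1)%:R); apply: cvgM; first exact: cvg_cst.
  exact: cvg_harmonic.
by apply: squeeze_cvgr (cvg_cst (0 : R)) lim0; apply: nearW => M; rewrite normr_ge0 bound.
Qed.

End tail.

(** * Assembling the limit *)

Lemma P_factorE (R : realType) (B d : nat) (a b : 'I_d -> R) n :
  let g m := \prod_(i < d) ((B%:R * m%:R + a i) / (B%:R * m%:R + b i)) in
  P_factor B a b n = g n * \prod_(0 <= k < B) (g (B * n + k)%N)^-1.
Proof.
move=> g; rewrite /P_factor big_split/=; congr (_ * _).
rewrite exchange_big/=; apply: eq_bigr => k _.
rewrite /g -prodfV; apply: eq_bigr => i _.
by rewrite invf_div natrD natrM mulrDr mulrA -expr2.
Qed.

Lemma count_residue_cvgy B Q v : (0 < B)%N -> (0 < v <= Q)%N ->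
  ((B * M.+1 + Q.-1 - v) %/ Q)%N @[M --> \oo] --> \oo.
Proof.
move=> B0 /andP[v0 vQ]; apply/cvgnyPge => K; near=> M.
rewrite leq_divRL ?(leq_trans v0)//.
have KM : (K * Q <= M)%N by near: M; exact: nbhs_infty_ge.
have : (M.+1 <= B * M.+1)%N by rewrite leq_pmull.
lia.
Unshelve. all: by end_near. Qed.

(** Both cases of the theorem at once: [x] is 1 for a zero word and [word_val B w / B ^ size w]
    otherwise. *)
Lemma prod_P_factor_cvg (R : realType) (B : nat) (w : seq nat) (d : nat)
    (a b : 'I_d -> R) :
  (1 < B)%N -> w != [::] -> all (fun c => (c < B)%N) w ->
  (forall i, 0 <= a i) -> (forall i, 0 <= b i) ->
  \sum_(i < d) a i = \sum_(i < d) b i ->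
  let x : R := (residue B w)%:R / B%:R ^+ size w in
  \prod_(1 <= n < M.+1) P_factor B a b n ^+ N_word B w n @[M --> \oo] -->
    \prod_(i < d) (Gamma (x + b i / B%:R ^+ (size w).+1) /
                   Gamma (x + a i / B%:R ^+ (size w).+1)).
Proof.
move=> B1 w0 ltw a0 b0 ab x.
have B0 := ltnW B1; have BR0 : (0 : R) < B%:R by rewrite ltr0n.
set Q := (B ^ size w)%N; set v := residue B w.
have vQ : (0 < v <= Q)%N := residue_bounds B1 ltw.
have Q0 : (0 < Q)%N by rewrite expn_gt0 B0.
have QR0 : (0 : R) < Q%:R by rewrite ltr0n.
pose g m : R := \prod_(i < d) ((B%:R * m%:R + a i) / (B%:R * m%:R + b i)).
have den0 (c : R) n : 0 <= c -> (0 < n)%N -> 0 < B%:R * n%:R + c.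
  by move=> c0 n0; rewrite ltr_wpDr// mulr_gt0// ltr0n.
have g0 n : (0 < n)%N -> 0 < g n.
  by move=> n0; apply: prodr_gt0 => i _; rewrite divr_gt0// den0.
have gln n : (0 < n)%N ->
    `|ln (g n)| <= (\sum_(i < d) (a i ^+ 2 + b i ^+ 2)) / B%:R ^+ 2 / n%:R ^+ 2.
  move=> n0; have := ln_ratio_le a0 b0 ab (mulr_gt0 BR0 (_ : 0 < n%:R)).
  by rewrite ltr0n n0 exprMn invfM mulrA; apply.
(* The guard matters when [v = Q]: then 0 lies in the class, yet [N_word] is 0 there. *)
pose e n : nat := (0 < n)%N && (n == v %[mod Q]).
have Ne n : N_word B w n = (N_word B w (n %/ B) + e n)%N.
  have [->|n0] := posnP n; first by rewrite div0n /e addn0.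
  by rewrite N_word_rec// /e n0.
have -> : (fun M => \prod_(1 <= n < M.+1) P_factor B a b n ^+ N_word B w n) =
    (fun M => \prod_(m < (B * M.+1 + Q.-1 - v) %/ Q) g (v + Q * m)%N /
       \prod_(M.+1 <= n < B * M.+1) g n ^+ N_word B w n).
  apply/funext => M; rewrite -(prod_residue _ _ vQ) -(prod_block_expN M B0 _ _ Ne)//.
  - by apply: eq_bigr => n _; rewrite P_factorE.
  - by move=> n /g0; exact: lt0r_neq0.
rewrite -[X in _ --> X]divr1; apply: cvgM; last first.
  apply: cvgV; first exact: oner_neq0.
  apply: (prod_tail_cvg1 (c := (size w).+1)) gln _ => //.
    by rewrite divr_ge0// ?exprn_ge0// sumr_ge0// => i _; rewrite addr_ge0// sqr_ge0.
  by move=> n; rewrite addSnnS; exact: N_word_le.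
have x0 : 0 < x by rewrite divr_gt0 ?exprn_gt0// ltr0n; case/andP: vQ.
(* Numerator and denominator are divided by [B * Q = B ^ (size w).+1]. *)
have gE m : g (v + Q * m)%N = \prod_(i < d)
    ((m%:R + (x + a i / B%:R ^+ (size w).+1)) /
     (m%:R + (x + b i / B%:R ^+ (size w).+1))).
  have QE : B%:R ^+ (size w) = Q%:R :> R by rewrite -natrX.
  have frac (c : R) : B%:R * (v + Q * m)%:R + c =
      B%:R * Q%:R * (m%:R + (x + c / B%:R ^+ (size w).+1)).
    by rewrite /x exprS QE natrD natrM; field; rewrite !gt_eqF.
  apply: eq_bigr => i _; rewrite !frac -mulf_div divff ?mul1r//.
  by rewrite mulf_neq0// gt_eqF.
have lim : \prod_(m < n) g (v + Q * m)%N @[n --> \oo] -->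
    \prod_(i < d) (Gamma (x + b i / B%:R ^+ (size w).+1) /
                   Gamma (x + a i / B%:R ^+ (size w).+1)).
  under eq_cvg do under eq_bigr do rewrite gE.
  apply: (prod_ratio_cvg (@Gamma_gt0 R) (@GammaD1 R) (@GammaD_le R)) => //.
  - by move=> i; rewrite divr_ge0// exprn_ge0.
  - by move=> i; rewrite divr_ge0// exprn_ge0.
  - by rewrite -!mulr_suml ab.
(* The number of factors tends to infinity with [M]. *)
exact: cvg_comp (count_residue_cvgy B0 vQ) lim.
Qed.

Theorem theorem2 (R : realType) (B : nat) (w : seq nat) (d : nat)
    (a b : 'I_d -> R)
    (hB : (2 <= B)%N)
    (hw0 : w <> [::])
    (hw : all (fun c => (c < B)%N) w)
    (hd : (1 <= d)%N)
    (ha : forall i, 0 <= a i)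
    (hb : forall i, 0 <= b i)
    (hab : \sum_(i < d) a i = \sum_(i < d) b i) :
  (forall j : nat, (1 <= j)%N -> w = nseq j 0%N ->
     (fun M : nat => \prod_(1 <= n < M.+1) P_factor B a b n ^+ N_word B w n)
       @ \oo -->
     \prod_(i < d)
       (Gamma (1 + b i / B%:R ^+ j.+1) / Gamma (1 + a i / B%:R ^+ j.+1)))
  /\
  ((forall j : nat, (1 <= j)%N -> w <> nseq j 0%N) ->
     (fun M : nat => \prod_(1 <= n < M.+1) P_factor B a b n ^+ N_word B w n)
       @ \oo -->
     \prod_(i < d)
       (Gamma ((word_val B w)%:R / B%:R ^+ size w + b i / B%:R ^+ (size w).+1) /
        Gamma ((word_val B w)%:R / B%:R ^+ size w + a i / B%:R ^+ (size w).+1))).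
Proof.
have /eqP w0 := hw0.
have := prod_P_factor_cvg hB w0 hw ha hb hab; rewrite /residue => lim; split.
  move=> j _ wj; have szw : size w = j by rewrite wj size_nseq.
  have zw : zero_word w by rewrite /zero_word szw wj.
  move: lim; rewrite zw szw natrX divff//.
  by rewrite expf_neq0// pnatr_eq0 -lt0n ltnW.
move=> nzw; have zw : ~~ zero_word w.
  by apply/eqP => ew; apply: (nzw (size w)) => //; rewrite lt0n size_eq0.
by move: lim; rewrite (negbTE zw).
Qed.
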